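(* Let $A$ be a simple abelian variety of dimension $g$ over $\mathbf{F}_q$ with associated Weil number $\pi$. Let $n=[\mathbf{Q}(\pi):\mathbf{Q}]$ and let $\Delta$ be the discriminant of the number field $\mathbf{Q}(\pi)$. Then the root discriminant $\mathrm{rd} := |\Delta|^{1/n}$ of $\mathbf{Q}(\pi)$ satisfies \[\mathrm{rd} \le 2g\,q^{g/2}.\]
   Context: For a simple abelian variety $A$ over $\mathbf{F}_q$, the Weil polynomial $\det(T-F\mid H^1(A))$ ($F$ the $q$-Frobenius) equals $h_A(T)^e$ for an irreducible $h_A\in\mathbf{Z}[T]$ and some $e\ge1$; the associated Weil number $\pi$ is a root of $h_A$, and $\mathbf{Q}(\pi)\cong\mathbf{Q}[T]/(h_A)$. *)

(* Defs.v *)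
From HB Require Import structures.
From mathcomp Require Export all_boot all_order all_algebra all_field.
From mathcomp Require Export mpoly.

Set Implicit Arguments.
Unset Strict Implicit.
Unset Printing Implicit Defensive.

Import Order.TTheory GRing.Theory Num.Theory.
Local Open Scope ring_scope.

Section ProjectiveSpace.

Variable K : fieldType.

(* A point of P^N(K) is a line in K^(N+1). *)
Record proj_point (N : nat) := ProjPoint {
  pline : {vspace 'rV[K]_N.+1};
  pline_dim : \dim pline == 1%N
}.

Definition hcoords N (p : proj_point N) (v : 'rV[K]_N.+1) : bool :=
  (v != 0) && (v \in pline p).

Definition peval (F : fieldType) (iota : {rmorphism F -> K}) (n : nat)
    (f : {mpoly F[n]}) (v : 'rV[K]_n) : K :=
  (map_mpoly iota f).@[fun i => v ord0 i].

Definition zero_locus (F : fieldType) (iota : {rmorphism F -> K}) (N : nat)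
    (S : seq {mpoly F[N.+1]}) (p : proj_point N) : Prop :=
  forall f v, f \in S -> hcoords p v -> peval iota f v = 0.

(* Zariski closed subsets of P^N(K) cut out by equations over the subfield F. *)
Definition closed_over (F : fieldType) (iota : {rmorphism F -> K}) (N : nat)
    (Z : proj_point N -> Prop) : Prop :=
  exists S : seq {mpoly F[N.+1]},
    (forall f, f \in S -> exists d : nat, f \is d.-homog) /\
    (forall p, Z p <-> zero_locus iota S p).

Definition zclosed (N : nat) (Z : proj_point N -> Prop) : Prop :=
  closed_over (idfun : {rmorphism K -> K}) Z.

Definition subset_pts (N : nat) (Y Z : proj_point N -> Prop) : Prop :=
  forall p, Y p -> Z p.

Definition zirreducible (N : nat) (Z : proj_point N -> Prop) : Prop :=
  (exists p, Z p) /\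
  forall Z1 Z2 : proj_point N -> Prop, zclosed Z1 -> zclosed Z2 ->
    subset_pts Z (fun p => Z1 p \/ Z2 p) -> subset_pts Z Z1 \/ subset_pts Z Z2.

Definition has_chain (N : nat) (X : proj_point N -> Prop) (d : nat) : Prop :=
  exists C : nat -> proj_point N -> Prop,
    (forall i, (i <= d)%N ->
       [/\ zclosed (C i), zirreducible (C i) & subset_pts (C i) X]) /\
    (forall i, (i < d)%N ->
       subset_pts (C i) (C i.+1) /\ ~ subset_pts (C i.+1) (C i)).

(* Krull dimension. *)
Definition zdim (N : nat) (X : proj_point N -> Prop) (d : nat) : Prop :=
  has_chain X d /\ ~ has_chain X d.+1.

End ProjectiveSpace.

Section Morphisms.

Variables (F K : fieldType) (iota : {rmorphism F -> K}).

(* phi restricts to a morphism of F-varieties on X: near each point of X it is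
   given by forms of one degree with coefficients in F.  The values of phi off X
   are irrelevant. *)
Definition regular_on (N M : nat) (X : proj_point K N -> Prop)
    (phi : proj_point K N -> proj_point K M) : Prop :=
  forall p, X p ->
  exists (d : nat) (f : 'I_M.+1 -> {mpoly F[N.+1]}),
    let fv (v : 'rV[K]_N.+1) : 'rV[K]_M.+1 := \row_i peval iota (f i) v in
    [/\ forall i, f i \is d.-homog,
        exists2 v, hcoords p v & fv v != 0
      & forall p' v, X p' -> hcoords p' v -> fv v != 0 ->
          hcoords (phi p') (fv v)].

Definition bihomog (m n : nat) (d1 d2 : nat) (f : {mpoly F[m + n]}) : Prop :=
  forall u : 'X_{1..(m + n)}, u \in msupp f ->
    (\sum_(i < m) u (lshift n i) = d1)%N /\ (\sum_(i < n) u (rshift m i) = d2)%N.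

Definition regular2_on (N M : nat) (X : proj_point K N -> Prop)
    (phi : proj_point K N -> proj_point K N -> proj_point K M) : Prop :=
  forall p1 p2, X p1 -> X p2 ->
  exists (d1 d2 : nat) (f : 'I_M.+1 -> {mpoly F[N.+1 + N.+1]}),
    let fv (v w : 'rV[K]_N.+1) : 'rV[K]_M.+1 :=
      \row_i peval iota (f i) (row_mx v w) in
    [/\ forall i, bihomog d1 d2 (f i),
        exists v w, [/\ hcoords p1 v, hcoords p2 w & fv v w != 0]
      & forall p1' p2' v w, X p1' -> X p2' -> hcoords p1' v -> hcoords p2' w ->
          fv v w != 0 -> hcoords (phi p1' p2') (fv v w)].

Definition algebraic_closure : Prop := forall x : K, algebraicOver iota x.

End Morphisms.

(* An abelian variety over the finite field F: a geometrically irreducible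
   projective variety with a group law defined over F, described through its
   points over the algebraic closure K of F.  Since F is perfect, reduced
   subschemes of P^N over F correspond to the sets [closed_over iota], and group
   varieties are automatically smooth; commutativity of the law is a theorem. *)
Record abelian_variety (F : finFieldType) (K : closedFieldType)
    (iota : {rmorphism F -> K}) := AbelianVariety {
  av_N : nat;
  av_pts : proj_point K av_N -> Prop;
  av_zero : proj_point K av_N;
  av_opp : proj_point K av_N -> proj_point K av_N;
  av_add : proj_point K av_N -> proj_point K av_N -> proj_point K av_N;
  av_closed : closed_over iota av_pts;
  av_irreducible : zirreducible av_pts;
  av_zeroP : av_pts av_zero;
  av_oppP : forall x, av_pts x -> av_pts (av_opp x);
  av_addP : forall x y, av_pts x -> av_pts y -> av_pts (av_add x y);
  av_zero_rational : exists v : 'rV[F]_av_N.+1,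
    hcoords av_zero (map_mx iota v);
  av_opp_regular : regular_on iota av_pts av_opp;
  av_add_regular : regular2_on iota av_pts av_add;
  av_addA : forall x y z, av_pts x -> av_pts y -> av_pts z ->
    av_add x (av_add y z) = av_add (av_add x y) z;
  av_add0 : forall x, av_pts x -> av_add av_zero x = x /\ av_add x av_zero = x;
  av_addN : forall x, av_pts x ->
    av_add (av_opp x) x = av_zero /\ av_add x (av_opp x) = av_zero
}.

Section AbelianVarieties.

Variables (F : finFieldType) (K : closedFieldType) (iota : {rmorphism F -> K}).
Variable A : abelian_variety iota.

Notation point := (proj_point K (av_N A)).

Definition av_dim (g : nat) : Prop := zdim (av_pts (a := A)) g.

Definition abelian_subvariety (B : point -> Prop) : Prop :=
  [/\ closed_over iota B, zirreducible B & subset_pts B (av_pts (a := A))] /\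
  [/\ B (av_zero A),
      forall x, B x -> B (av_opp x)
    & forall x y, B x -> B y -> B (av_add x y)].

Definition av_simple : Prop :=
  (exists2 x, av_pts (a := A) x & x <> av_zero A) /\
  forall B, abelian_subvariety B ->
    (forall x, B x -> x = av_zero A) \/ subset_pts (av_pts (a := A)) B.

Definition av_muln (n : nat) (x : point) : point :=
  iter n (av_add x) (av_zero A).

Definition av_mulz (c : int) (x : point) : point :=
  match c with
  | Posz n => av_muln n x
  | Negz n => av_opp (av_muln n.+1 x)
  end.

(* y is the image of x under the q-Frobenius, q = #|F|. *)
Definition frobenius_image (x y : point) : Prop :=
  forall v, hcoords x v -> hcoords y (map_mx (fun t => t ^+ #|F|) v).

(* An l-adic integer, given by representatives c k of its residues mod l^k. *)
Definition padic_seq (l : nat) (c : nat -> int) : Prop :=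
  forall k : nat, (c k.+1 = c k %[mod (l ^ k)%:Z])%Z.

(* The elements of the Tate module T_l A = lim A[l^k](K). *)
Definition tate_elt (l : nat) (x : nat -> point) : Prop :=
  [/\ forall k, av_pts (x k), x 0%N = av_zero A
    & forall k, av_muln l (x k.+1) = x k].

(* The level-k component of a combination of elements of T_l A. *)
Definition tate_comb (r : nat) (c : 'I_r -> int) (e : 'I_r -> nat -> point)
    (k : nat) : point :=
  \big[@av_add _ _ _ A/av_zero A]_(i < r) av_mulz (c i) (e i k).

(* e is a basis of T_l A as a module over the l-adic integers. *)
Definition tate_basis (l r : nat) (e : 'I_r -> nat -> point) : Prop :=
  [/\ forall i, tate_elt l (e i),
      forall x, tate_elt l x -> exists c : 'I_r -> nat -> int,
        (forall i, padic_seq l (c i)) /\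
        (forall k, x k = tate_comb (fun i => c i k) e k)
    & forall c : 'I_r -> nat -> int, (forall i, padic_seq l (c i)) ->
        (forall k, tate_comb (fun i => c i k) e k = av_zero A) ->
        forall i k, ((l ^ k)%:Z %| c i k)%Z].

(* P = det(T - F | T_l A), with T_l A free of rank r; M k represents mod l^k the
   matrix of F.  For l prime to q, H^1(A) is the l-adic cohomology
   Hom(T_l A, Q_l), on which F acts by the transpose, and r = 2 dim A. *)
Definition frobenius_charpoly (l r : nat) (P : {poly int}) : Prop :=
  exists (e : 'I_r -> nat -> point) (M : nat -> 'M[int]_r),
    [/\ tate_basis l e,
        forall i j, padic_seq l (fun k => M k i j),
        forall i k, frobenius_image (e i k) (tate_comb (M k i) e k)
      & forall k j : nat,
          ((char_poly (M k))`_j = P`_j %[mod (l ^ k)%:Z])%Z].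

End AbelianVarieties.

Definition irreducible_elt (R : idomainType) (x : R) : Prop :=
  [/\ x != 0, x \isn't a GRing.unit
    & forall a b : R, x = a * b ->
        a \is a GRing.unit \/ b \is a GRing.unit].

Section NumberFields.

Variable L : fieldExtType rat.

Definition alg_integer (x : L) : Prop := integralOver (intr : int -> L) x.

Definition weil_number (q : nat) (x : L) : Prop :=
  alg_integer x /\
  forall sigma : {rmorphism L -> algC}, `|sigma x| = sqrtC q%:R.

Definition field_trace (x : L) : rat :=
  \tr (\matrix_(i, j) coord (vbasis {:L}) j (x * tnth (vbasis {:L}) i)).

Definition integral_basis (b : (\dim {:L}).-tuple L) : Prop :=
  basis_of fullv b /\
  forall x : L, alg_integer x <->
    exists c : 'I_(\dim {:L}) -> int, x = \sum_i (c i)%:~R * tnth b i.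

Definition field_discriminant (Delta : int) : Prop :=
  exists2 b : (\dim {:L}).-tuple L, integral_basis b &
    Delta%:~R = \det (\matrix_(i, j) field_trace (tnth b i * tnth b j)).

End NumberFields.

(* Main.v *)
From HB Require Import structures.
Require Import Defs.
From mathcomp Require Import zify.
Set Implicit Arguments.
Unset Strict Implicit.
Unset Printing Implicit Defensive.
Import Order.TTheory GRing.Theory Num.Theory.
Local Open Scope ring_scope.

(* The Weil polynomial has degree at most 2g, so n = [Q(pi) : Q] <= 2g.  All the
   conjugates of pi have absolute value sqrt q, so q / pi is the complex
   conjugate of pi under every embedding, hence an algebraic integer.  Writing
   m = floor(n / 2), the n elements
     (q / pi)^m, ..., q / pi, 1, pi, ..., pi^(n - m - 1)
   are therefore integral, and they are independent over Q, so |Delta| is at most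
   the squared absolute value of the determinant of the matrix of their
   conjugates.  Hadamard's inequality bounds this by n^n q^D, where
   D = sum_(i < n) |i - m| = floor(n^2 / 4); hence
   rd <= n q^(n / 4) <= 2g q^(g / 2).
   The plain power basis would only give rd <= n q^((n - 1) / 2). *)

Section Hadamard.

Local Open Scope sesquilinear_scope.

Variable C : numClosedFieldType.

Lemma mulmx_adjoint_dotmx m n p (A : 'M[C]_(m, n)) (B : 'M[C]_(p, n)) i j :
  (A *m B^t*) i j = dotmx (row i A) (row j B).
Proof. by rewrite dotmxE !mxE; apply: eq_bigr => k _; rewrite !mxE. Qed.

Lemma dotmx_norm n (u : 'rV[C]_n) : dotmx u u = \sum_j `|u 0 j| ^+ 2.
Proof. by rewrite dotmxE mxE; apply: eq_bigr => j _; rewrite !mxE normCK. Qed.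

Lemma norm_det_unitarymx n (U : 'M[C]_n) : U \is unitarymx -> `|\det U| = 1.
Proof.
move=> /unitarymxP/(congr1 determinant).
rewrite det_mulmx det1 det_map_mx det_tr -normCK => /eqP.
by rewrite sqrp_eq1 ?normr_ge0 // => /eqP.
Qed.

Lemma mulmx_schmidt_trig n (A : 'M[C]_n) : is_trig_mx (A *m (schmidt A)^t*).
Proof.
apply/is_trig_mxP => i j lt_ij; rewrite mulmx_adjoint_dotmx.
have /row_unitarymxP orthoU := schmidt_unitarymx A (leqnn n).
have /sub_kermxP rA0 : (row i A <= kermx ((row j (schmidt A))^t*))%MS.
  apply: submx_trans (row_schmidt_sub A i) _; apply/sumsmx_subP => k le_ki.
  rewrite genmxE; apply/sub_kermxP/matrixP => a b.
  rewrite !ord1 -dotmxE orthoU mxE.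
  by rewrite -val_eqE ltn_eqF // (leq_ltn_trans le_ki).
by rewrite dotmxE rA0 mxE.
Qed.

(* A U^* is triangular for the Gram-Schmidt orthonormalisation U of the rows of A,
   and Cauchy-Schwarz bounds its i-th diagonal entry by the norm of row i of A. *)
Lemma hadamard_det_le n (A : 'M[C]_n) :
  `|\det A| ^+ 2 <= \prod_i \sum_j `|A i j| ^+ 2.
Proof.
pose U := schmidt A.
have unitU : U \is unitarymx by exact: schmidt_unitarymx.
have -> : `|\det A| = `|\det (A *m U^t*)|.
  have norm_detU : `|\det (U^t*)| = 1.
    by apply: norm_det_unitarymx; rewrite trmxC_unitary.
  by rewrite det_mulmx normrM norm_detU mulr1.
rewrite (det_trig (mulmx_schmidt_trig A)) normr_prod -prodrXl.
apply: ler_prod => i _; rewrite exprn_ge0 ?normr_ge0 //= mulmx_adjoint_dotmx.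
apply: le_trans (CauchySchwarz (@dotmx C n) (row i A) (row i U)) _.
rewrite [X in _ * X](row_unitarymxP unitU) eqxx mulr1 /= dotmx_norm.
by under [leLHS]eq_bigr do rewrite mxE.
Qed.

End Hadamard.

Lemma dvdz_all_exp_eq0 (l : nat) (a : int) :
  (1 < l)%N -> (forall k, ((l ^ k)%:Z %| a)%Z) -> a = 0.
Proof.
move=> l_gt1 /(_ `|a|%N); rewrite dvdzE absz_nat => /dvdn_leq le_a.
apply/eqP; rewrite -absz_eq0 -leqn0 leqNgt; apply/negP => /le_a.
by rewrite leqNgt ltn_expl.
Qed.

Lemma sum_distn_half n : (\sum_(i < n) `|i - n./2| = n ^ 2 %/ 4)%N.
Proof.
elim/ltn_ind: n => -[|[|n]] IHn; rewrite ?big_ord0 ?big_ord1 //.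
rewrite big_ord_recl big_ord_recr /=.
under eq_bigr => i _ do rewrite /bump /= !add1n -!(addn1 i) -(addn1 n./2) distnDr.
rewrite IHn ?leqnSn // /bump /= add1n.
have := odd_double_half n; case: odd => /=; lia.
Qed.

Lemma map_poly_rmorph_int (R S : nzRingType) (f : {rmorphism R -> S})
    (p : {poly int}) :
  map_poly f (map_poly intr p) = map_poly intr p.
Proof.
by rewrite -map_poly_comp; apply: eq_map_poly => z /=; rewrite rmorph_int.
Qed.

Lemma separable_poly_roots (K : closedFieldType) (p : {poly K}) :
  separable_poly p ->
  exists r : seq K, [/\ uniq r, size r = (size p).-1 & all (root p) r].
Proof.
move=> sep_p; have [r Dp] := closed_field_poly_normal p.
have nz_lc : lead_coef p != 0 by rewrite lead_coef_eq0 separable_poly_neq0.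
exists r; split; first 2 last.
- by apply/allP => z r_z; rewrite Dp rootZ // root_prod_XsubC.
- by rewrite -separable_prod_XsubC -(eqp_separable (eqp_scale _ nz_lc)) -Dp.
- by rewrite Dp size_scale // size_prod_XsubC.
Qed.

Lemma rmorph_factor (R S T : nzRingType)
    (f : {rmorphism R -> S}) (g : {rmorphism R -> T}) :
    (forall y, exists a, f a == y) -> (forall a, f a = 0 -> g a = 0) ->
  exists h : {rmorphism S -> T}, h \o f =1 g.
Proof.
move=> f_surj ker_fg; pose h y := g (xchoose (f_surj y)).
have hE a : h (f a) = g a.
  apply/eqP; rewrite -subr_eq0 -rmorphB ker_fg // rmorphB.
  by rewrite (eqP (xchooseP (f_surj (f a)))) subrr.
have hB : zmod_morphism h.
  move=> y1 y2; have [[a1 /eqP<-] [a2 /eqP<-]] := (f_surj y1, f_surj y2).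
  by rewrite -rmorphB !hE rmorphB.
have hM : monoid_morphism h.
  split=> [|y1 y2]; first by rewrite -(rmorph1 f) hE rmorph1.
  have [[a1 /eqP<-] [a2 /eqP<-]] := (f_surj y1, f_surj y2).
  by rewrite -rmorphM !hE rmorphM.
pose hRM : {rmorphism S -> T} := HB.pack h
  (GRing.isZmodMorphism.Build _ _ h hB) (GRing.isMonoidMorphism.Build _ _ h hM).
by exists hRM.
Qed.

Section SimpleExtension.

Variables (F : fieldType) (L : fieldExtType F) (x : L).

Lemma adjoin_degree_lt_size (E : {subfield L}) (p : {poly L}) :
  p \is a polyOver E -> root p x -> p != 0 -> (adjoin_degree E x < size p)%N.
Proof.
move=> Ep px0; rewrite ltnNge; apply: contraNN => le_p.
by rewrite -(root_small_adjoin_poly Ep le_p).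
Qed.

Hypothesis genL : <<1; x>>%VS = fullv.

Lemma dim_simple_ext : \dim {:L} = adjoin_degree 1 x.
Proof. by rewrite -genL (@dim_Fadjoin _ _ 1%AS) dimv1 muln1. Qed.

Lemma extend_rmorph_to_root (K : fieldType) (iota : {rmorphism F -> K}) (z : K) :
    (forall p, root (map_poly (in_alg L) p) x -> root (map_poly iota p) z) ->
  exists sigma : {rmorphism L -> K}, sigma \o in_alg L =1 iota /\ sigma x = z.
Proof.
move=> root_z; have comm_z : commr_rmorph iota z by move=> a; exact: mulrC.
have [y | p /rootP/root_z/rootP // | sigma Dsigma] :=
    @rmorph_factor _ _ _ (fieldExt_horner x) (horner_morph comm_z).
  have /Fadjoin1_polyP[p ->] : y \in <<1; x>>%VS by rewrite genL memvf.
  by exists p.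
exists sigma; split=> [a|].
  by have := Dsigma a%:P; rewrite /= horner_morphC fieldExt_hornerC.
by have := Dsigma 'X; rewrite /= horner_morphX fieldExt_hornerX.
Qed.

Lemma separable_embeddings (K : closedFieldType) (iota : {rmorphism F -> K}) :
    separable_element 1 x ->
  exists s : 'I_(\dim {:L}) -> {rmorphism L -> K},
    (forall k, s k \o in_alg L =1 iota) /\ injective (fun k => s k x).
Proof.
have /polyOver1P[p Dp] := minPolyOver 1%AS x; rewrite /separable_element Dp.
rewrite separable_map -(separable_map iota) => /separable_poly_roots[r [Ur]].
rewrite size_map_poly -(size_map_poly (in_alg L)) -Dp size_minPoly /=.
rewrite -dim_simple_ext => szr /allP root_r.
have ex_sigma (k : 'I_(\dim {:L})) :
    exists sigma : {rmorphism L -> K},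
      sigma \o in_alg L =1 iota /\ sigma x = r`_k.
  apply: extend_rmorph_to_root => q qx0.
  have : minPoly 1 x %| map_poly (in_alg L) q.
    by apply: (@minPoly_dvdp _ _ 1%AS) => //; apply: alg_polyOver.
  rewrite Dp dvdp_map -(dvdp_map iota) -dvdp_XsubCl; apply: dvdp_trans.
  by rewrite dvdp_XsubCl root_r // mem_nth ?szr.
have [s Ds] := fin_all_exists ex_sigma.
exists s; split=> [k | j k]; first by case: (Ds k).
case: (Ds j) (Ds k) => _ -> [_ ->] /eqP.
by rewrite nth_uniq ?szr // => /eqP/val_inj.
Qed.

End SimpleExtension.

Section Embeddings.

Variable L : fieldExtType rat.

Local Notation n := (\dim {:L}).

Lemma alg_integer_Aint (sigma : {rmorphism L -> algC}) y :
  alg_integer y <-> sigma y \in Aint.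
Proof.
have root_sigma p : root (map_poly intr p) (sigma y) = root (map_poly intr p) y.
  by rewrite -(map_poly_rmorph_int sigma) fmorph_root.
split=> [[p mon_p py0] | y_int].
  apply: (@root_monic_Aint (map_poly intr p)); first by rewrite root_sigma.
    by rewrite monic_map.
  by apply/polyOverP => i; rewrite coef_map /= intr_int.
have /floorpP[p Dp] := y_int.
exists p; last by rewrite -root_sigma -Dp root_minCpoly.
have := minCpoly_monic (sigma y); rewrite Dp !monicE lead_coef_map_inj //.
  by rewrite (eqr_int _ _ 1).
exact: intr_inj.
Qed.

Variable s : 'I_n -> {rmorphism L -> algC}.

Definition embed_mx m (a : 'I_m -> L) : 'M[algC]_(m, n) :=
  \matrix_(i, k) s k (a i).

Lemma embed_mx_lincomb m p (M : 'M[rat]_(m, p)) (a : 'I_m -> L) (b : 'I_p -> L) :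
    (forall i, a i = \sum_j M i j *: b j) ->
  embed_mx a = map_mx ratr M *m embed_mx b.
Proof.
move=> Da; apply/matrixP => i k; rewrite !mxE Da rmorph_sum.
by apply: eq_bigr => j _; rewrite !mxE rmorphZ_num.
Qed.

Lemma embed_mx_mull m (y : L) (a : 'I_m -> L) :
  embed_mx (fun i => y * a i) = embed_mx a *m diag_mx (\row_k s k y).
Proof. by apply/matrixP => i k; rewrite mul_mx_diag !mxE rmorphM mulrC. Qed.

Variable x : L.
Hypothesis s_inj : injective (fun k => s k x).

Lemma det_embed_powers_neq0 : \det (embed_mx (fun i : 'I_n => x ^+ i)) != 0.
Proof.
have -> : embed_mx (fun i : 'I_n => x ^+ i) = Vandermonde n (\row_k s k x).
  by apply/matrixP => i k; rewrite !mxE rmorphXn.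
rewrite det_Vandermonde; apply/prodf_neq0 => i _; apply/prodf_neq0 => j lt_ij.
rewrite !mxE subr_eq0; apply/eqP => /s_inj eji.
by rewrite eji ltnn in lt_ij.
Qed.

Lemma embed_basis_unit (b : n.-tuple L) :
  basis_of fullv b -> embed_mx (tnth b) \in unitmx.
Proof.
move=> basis_b; rewrite unitmxE unitfE.
apply: contraNneq det_embed_powers_neq0 => detB0.
rewrite (embed_mx_lincomb (M := \matrix_(i, j) coord b j (x ^+ i)) (b := tnth b)).
  by rewrite det_mulmx detB0 mulr0.
move=> i; rewrite [LHS](coord_basis basis_b (memvf _)).
by apply: eq_bigr => j _; rewrite mxE -tnth_nth.
Qed.

Lemma ratr_field_trace y : ratr (field_trace y) = \sum_k s k y.
Proof.
pose b := vbasis {:L}.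
pose M := \matrix_(i, j) coord b j (y * tnth b i).
have unitB : embed_mx (tnth b) \in unitmx by exact/embed_basis_unit/vbasisP.
have MB : map_mx ratr M *m embed_mx (tnth b) =
          embed_mx (tnth b) *m diag_mx (\row_k s k y).
  rewrite -embed_mx_mull; apply/esym/embed_mx_lincomb => i.
  rewrite [LHS](coord_vbasis (memvf _)).
  by apply: eq_bigr => j _; rewrite mxE -tnth_nth.
rewrite -[LHS]/(ratr (\tr M)) -trace_map_mx -[map_mx _ _](mulmxK unitB) MB.
rewrite mxtrace_mulC mulKmx // mxtrace_diag.
by apply: eq_bigr => k _; rewrite mxE.
Qed.

Lemma map_trace_form_mx m (a : 'I_m -> L) :
  map_mx ratr (\matrix_(i, j) field_trace (a i * a j)) =
    embed_mx a *m (embed_mx a)^T.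
Proof.
apply/matrixP => i j; rewrite !mxE /= ratr_field_trace.
by apply: eq_bigr => k _; rewrite !mxE rmorphM.
Qed.

Lemma field_discriminant_le (Delta : int) (a : 'I_n -> L) :
    field_discriminant L Delta -> (forall i, alg_integer (a i)) ->
    \det (embed_mx a) != 0 ->
  `|Delta|%:~R <= `|\det (embed_mx a)| ^+ 2.
Proof.
case=> b [_ int_b] DDelta a_int.
have /fin_all_exists[c Dc] i :
    exists ci : 'I_n -> int, a i = \sum_j (ci j)%:~R * tnth b j.
  by apply/int_b.
(* |det M| is the index in the ring of integers of the lattice spanned by a. *)
pose M := \matrix_(i, j) c i j.
have -> : embed_mx a = map_mx intr M *m embed_mx (tnth b).
  rewrite (embed_mx_lincomb (M := map_mx intr M) (b := tnth b)) => [|i].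
    by congr (_ *m _); apply/matrixP => i j; rewrite !mxE ratr_int.
  by rewrite Dc; apply: eq_bigr => j _; rewrite !mxE scaler_int mulrzl.
have DeltaE : Delta%:~R = \det (embed_mx (tnth b)) ^+ 2.
  rewrite -[LHS](ratr_int algC) DDelta -det_map_mx map_trace_form_mx.
  by rewrite det_mulmx det_tr.
rewrite det_mulmx det_map_mx mulf_eq0 negb_or intr_eq0 => /andP[nz_M _].
rewrite intr_norm DeltaE normrX normrM exprMn ler_peMl ?exprn_ge0 //.
by rewrite exprn_ege1 // -intr_norm ler1z -gtz0_ge1 normr_gt0.
Qed.

End Embeddings.

Section WeilNumbers.

Variables (L : fieldExtType rat) (x : L) (q : nat).
Hypothesis q_gt0 : (0 < q)%N.
Hypothesis weil_x : weil_number q x.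

Local Notation n := (\dim {:L}).

(* As the subtraction is truncated, this is x ^ (i - c) for c <= i and
   (q / x) ^ (c - i) for i < c. *)
Definition centered_power (c i : nat) : L := q%:R ^+ (c - i) * x ^+ i / x ^+ c.

Section OneEmbedding.

Variable sigma : {rmorphism L -> algC}.

Lemma norm_weil_number : `|sigma x| ^+ 2 = q%:R.
Proof. by have [_ ->] := weil_x; rewrite sqrtCK. Qed.

Lemma embed_weil_number_neq0 : sigma x != 0.
Proof. by rewrite -normr_eq0 -sqrf_eq0 norm_weil_number pnatr_eq0 -lt0n. Qed.

Lemma embed_centered_power c i :
  sigma (centered_power c i) =
    if (c <= i)%N then sigma x ^+ (i - c) else (sigma x)^* ^+ (c - i).
Proof.
have nz_sx := embed_weil_number_neq0.
rewrite fmorph_div rmorphM !rmorphXn rmorph_nat.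
apply: (canLR (mulfK _)); first by rewrite expf_neq0.
case: leqP => [le_ci | /ltnW le_ic].
  by rewrite (eqP le_ci) mul1r -exprD subnK.
rewrite -[X in _ = _ * _ ^+ X](subnK le_ic) exprD mulrA -exprMn.
by rewrite [_^* * _]mulrC -normCK norm_weil_number.
Qed.

Lemma alg_integer_centered_power c i : alg_integer (centered_power c i).
Proof.
have sx_int : sigma x \in Aint by apply/alg_integer_Aint; case: weil_x.
apply/(alg_integer_Aint sigma); rewrite embed_centered_power.
by case: ifP => _; rewrite rpredX // Aint_aut.
Qed.

Lemma norm_centered_power c i :
  `|sigma (centered_power c i)| ^+ 2 = q%:R ^+ `|i - c|.
Proof.
rewrite embed_centered_power -norm_weil_number.
case: leqP => [le_ci | /ltnW le_ic]; rewrite normrX -exprM mulnC exprM.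
  by rewrite distnEl.
by rewrite norm_conjC distnEr.
Qed.

End OneEmbedding.

Section AllEmbeddings.

Variable s : 'I_n -> {rmorphism L -> algC}.
Hypothesis s_inj : injective (fun k => s k x).

Lemma det_embed_centered_power_neq0 c :
  \det (embed_mx s (fun i : 'I_n => centered_power c i)) != 0.
Proof.
have -> : embed_mx s (fun i : 'I_n => centered_power c i) =
    diag_mx (\row_i q%:R ^+ (c - i)) *m embed_mx s (fun i : 'I_n => x ^+ i)
      *m diag_mx (\row_k (s k x ^+ c)^-1).
  apply/matrixP => i k; rewrite mul_mx_diag mul_diag_mx !mxE.
  by rewrite fmorph_div rmorphM !rmorphXn rmorph_nat.
rewrite !det_mulmx !det_diag !mulf_neq0 ?det_embed_powers_neq0 //.
  by apply/prodf_neq0 => i _; rewrite mxE expf_neq0 // pnatr_eq0 -lt0n.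
apply/prodf_neq0 => k _.
by rewrite mxE invr_neq0 ?expf_neq0 ?embed_weil_number_neq0.
Qed.

Lemma norm_det_embed_centered_power_le c :
  `|\det (embed_mx s (fun i : 'I_n => centered_power c i))| ^+ 2 <=
    n%:R ^+ n * q%:R ^+ (\sum_(i < n) `|i - c|).
Proof.
apply: le_trans (hadamard_det_le _) _; rewrite -prodrXr.
under eq_bigr => i _ do under eq_bigr => k _ do rewrite mxE norm_centered_power.
under eq_bigr => i _ do rewrite sumr_const card_ord.
by rewrite prodrMn_const card_ord -mulr_natl natrX.
Qed.

End AllEmbeddings.

Hypothesis gen_x : <<1; x>>%VS = fullv.

Lemma weil_discriminant_le (Delta : int) : field_discriminant L Delta ->
  `|Delta|%:~R <= n%:R ^+ n * q%:R ^+ (n ^ 2 %/ 4) :> algC.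
Proof.
move=> hDelta.
have sep_x : separable_element 1 x.
  apply: (@pcharf0_separable _ _ 1%AS) => i.
  by rewrite pchar_lalg; apply: pchar_num.
have [s [_ s_inj]] :=
  separable_embeddings gen_x (ratr : {rmorphism rat -> algC}) sep_x.
rewrite -sum_distn_half.
apply: le_trans (norm_det_embed_centered_power_le s n./2).
apply: (field_discriminant_le s_inj hDelta) => [i|].
  exact/alg_integer_centered_power/(s i).
exact: det_embed_centered_power_neq0.
Qed.

Lemma weil_root_discriminant_le (Delta : int) : field_discriminant L Delta ->
  n.-root `|Delta|%:~R <= n%:R * 4.-root q%:R ^+ n :> algC.
Proof.
move=> hDelta; have n_gt0 : (0 < n)%N by exact: (adim_gt0 {:L}%AS).
have rq_ge1 : 1 <= 4.-root q%:R :> algC by rewrite rootC_ge1 ?ler1n.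
have rhs_ge0 : 0 <= n%:R * 4.-root q%:R ^+ n :> algC.
  by rewrite mulr_ge0 ?exprn_ge0 ?ler0n // (le_trans ler01).
rewrite -[leRHS](exprCK n_gt0 rhs_ge0) ler_rootCl ?nnegrE ?ler0z //.
apply: le_trans (weil_discriminant_le hDelta) _.
rewrite exprMn -exprM ler_wpM2l ?exprn_ge0 //.
rewrite -{1}(rootCK (isT : 0 < 4)%N q%:R) -exprM ler_weXn2l //.
by rewrite mulnn mulnC leq_trunc_div.
Qed.

End WeilNumbers.

Lemma size_frobenius_charpoly_le (F : finFieldType) (K : closedFieldType)
    (iota : {rmorphism F -> K}) (A : abelian_variety iota) l r (P : {poly int}) :
  (1 < l)%N -> frobenius_charpoly A l r P -> (size P <= r.+1)%N.
Proof.
move=> l_gt1 [e [M [_ _ _ DP]]]; apply/leq_sizeP => j le_rj.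
apply: (dvdz_all_exp_eq0 l_gt1) => k; have /eqP := DP k j.
by rewrite nth_default ?size_char_poly // eqz_mod_dvd sub0r rpredN.
Qed.

Lemma dim_num_field_lt_size (L : fieldExtType rat) (x : L) (h : {poly int}) :
    <<1; x>>%VS = fullv -> h != 0 -> root (map_poly intr h) x ->
  (\dim {:L} < size h)%N.
Proof.
move=> gen_x nz_h; rewrite -(map_poly_rmorph_int (in_alg L)) => hx0.
have szh : size (map_poly (in_alg L) (map_poly intr h)) = size h.
  by rewrite size_map_poly size_map_inj_poly //; apply: intr_inj.
rewrite (dim_simple_ext gen_x) -szh.
apply: (@adjoin_degree_lt_size _ _ _ 1%AS) => //; first exact: alg_polyOver.
by rewrite -size_poly_eq0 szh size_poly_eq0.
Qed.

Theorem theorem4p7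
  (F : finFieldType) (K : closedFieldType) (iota : {rmorphism F -> K})
  (hK : algebraic_closure iota)
  (A : abelian_variety iota) (hA : av_simple A)
  (g : nat) (hg : av_dim A g)
  (l : nat) (hl : prime l) (hlq : ~~ (l %| #|F|)%N)
  (P : {poly int}) (hP : frobenius_charpoly A l (2 * g)%N P)
  (h : {poly int}) (hirr : irreducible_elt h)
  (e : nat) (he : (1 <= e)%N) (hPe : P = h ^+ e)
  (L : fieldExtType rat) (pi : L) (hL : <<1; pi>>%VS = fullv)
  (hroot : root (map_poly (intr : int -> L) h) pi)
  (hpi : weil_number #|F| pi)
  (Delta : int) (hDelta : field_discriminant L Delta) :
  (\dim {:L}).-root (`|Delta|%:~R : algC) <= 2 * g%:R * sqrtC (#|F|%:R) ^+ g.
Proof.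
have q_gt0 : (0 < #|F|)%N by exact/ltnW/finNzRing_gt1.
have le_n_2g : (\dim {:L} <= 2 * g)%N.
  have [nz_h _ _] := hirr; have lt_n_h := dim_num_field_lt_size hL nz_h hroot.
  have le_h_P : ((size h).-1 <= (size P).-1)%N by rewrite hPe size_exp leq_pmulr.
  by have := size_frobenius_charpoly_le (prime_gt1 hl) hP; lia.
apply: le_trans (weil_root_discriminant_le q_gt0 hpi hL hDelta) _.
set r := 4.-root _; have r_ge1 : 1 <= r by rewrite rootC_ge1 ?ler1n.
have r_ge0 : 0 <= r := le_trans ler01 r_ge1.
have -> : sqrtC #|F|%:R = r ^+ 2.
  by rewrite -(sqrCK (exprn_ge0 2 r_ge0)) -exprM rootCK.
by rewrite -natrM -exprM ler_pM ?exprn_ge0 ?ler_nat ?ler_weXn2l.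
Qed.
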